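(* For every $\eta>0$ there exist constants $C>0$ and $\epsilon_0\in(0,1)$ such that for all $0<\epsilon\le\epsilon_0$ and all $n$: if $f:\{-1,1\}^n\to\{-1,1\}$ satisfies $\mathbf{E}[f]=0$ and $\mathrm{Inf}_i(f)\le\epsilon^{C/\epsilon}$ for all $i\in[n]$, then $$\mathbb{S}_{1-\epsilon}(f)\le 1-\Bigl(\frac{\sqrt8}{\pi}-\eta\Bigr)\epsilon^{1/2}.$$
   Context: $\{-1,1\}^n$ carries the uniform measure; $\hat f(S)=\mathbf{E}[f(x)\prod_{i\in S}x_i]$ are the Fourier coefficients. $\mathrm{Inf}_i(f)=\sum_{S\ni i}\hat f(S)^2$ and $\mathbb{S}_\rho(f)=\sum_S\rho^{|S|}\hat f(S)^2$. *)

(* Defs.v *)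
From HB Require Import structures.
From mathcomp Require Import all_boot all_order all_algebra.
From mathcomp Require Import reals.

Set Implicit Arguments.
Unset Strict Implicit.
Unset Printing Implicit Defensive.

Import Order.TTheory GRing.Theory Num.Theory.
Local Open Scope ring_scope.

(* The point x of {-1,1}^n is stored through its sign bits: the i-th coordinate
   is -1 if [x i] is true and 1 if it is false. *)
Definition cube (n : nat) := {ffun 'I_n -> bool}.

Section Fourier.
Variables (R : realType) (n : nat).
Implicit Types (f : cube n -> R) (x : cube n) (S : {set 'I_n}) (i : 'I_n).

Definition coord x i : R := (-1) ^+ x i.

Definition expect f : R := (\sum_(x : cube n) f x) / #|{: cube n}|%:R.

Definition fourier f S : R := expect (fun x => f x * \prod_(i in S) coord x i).

Definition influence f i : R := \sum_(S : {set 'I_n} | i \in S) fourier f S ^+ 2.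

Definition stability (rho : R) f : R :=
  \sum_(S : {set 'I_n}) rho ^+ #|S| * fourier f S ^+ 2.

Definition pm1_valued f : Prop := forall x, f x = 1 \/ f x = -1.

End Fourier.

(* Main.v *)
(* A balanced Boolean function f is smoothed to T_r f, r = 1 - c eps, which takes
   values in [-1, 1], and then truncated to degree d ~ log(1/eps) / eps; the
   result is a multilinear polynomial q with small influences.  Evaluate q at
   the points z_j = cos(j th) x + sin(j th) y, 0 <= j <= K, where x, y are
   independent uniform points of the cube and th = pi / (2 K): consecutive
   points have correlation cos th, so E[q(z_j) q(z_(j+1))] is the noise
   stability of q at cos th, while z_0 = x and z_K = y are independent.  If all
   q(z_j) were in [-1, 1], then
     sum_j q(z_j) q(z_(j+1)) <= K - 1 + q(z_0) q(z_K)
   pointwise, whence stability at most 1 - 1/K ~ 1 - (sqrt 8 / pi) sqrt eps.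
   The coordinates of z_j have mean 0, variance 1 and vanishing third moment but
   are not signs, so q(z_j) may leave [-1, 1].  A Lindeberg replacement of z_j
   by x, with a C^3 penalty function that vanishes on [-1, 1] and grows
   quadratically, together with (2,4)-hypercontractivity, shows that this
   happens with negligible effect. *)
Require Import Defs.
From mathcomp Require Import all_boot all_order all_algebra.
From mathcomp Require Import reals exp trigo.
From mathcomp Require Import topology normedtype sequences derive realfun.
From mathcomp Require Import ring lra.
Set Implicit Arguments.
Unset Strict Implicit.
Unset Printing Implicit Defensive.

Import Order.TTheory GRing.Theory Num.Theory numFieldNormedType.Exports.
Local Open Scope ring_scope.

(** * Averages over finite types *)

Section Average.
Variables (R : realType) (T : finType).
Implicit Types F G : T -> R.

Definition avg F : R := (\sum_t F t) / #|T|%:R.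

Lemma eq_avg F G : F =1 G -> avg F = avg G.
Proof. by move=> e; rewrite /avg; congr (_ / _); apply: eq_bigr => t _; apply: e. Qed.

Lemma avgD F G : avg (fun t => F t + G t) = avg F + avg G.
Proof. by rewrite /avg big_split mulrDl. Qed.

Lemma avgZ k F : avg (fun t => k * F t) = k * avg F.
Proof. by rewrite /avg -mulr_sumr mulrA. Qed.

Lemma avg_sum (I : Type) (r : seq I) (P : pred I) (F : I -> T -> R) :
  avg (fun t => \sum_(i <- r | P i) F i t) = \sum_(i <- r | P i) avg (F i).
Proof. by rewrite /avg exchange_big mulr_suml. Qed.

Lemma ler_avg F G : (forall t, F t <= G t) -> avg F <= avg G.
Proof.
move=> le_FG; rewrite /avg ler_wpM2r ?invr_ge0 ?ler0n //.
by apply: ler_sum => t _.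
Qed.

Lemma avg_cst k : (0 < #|T|)%N -> avg (fun=> k) = k.
Proof.
move=> T0; rewrite /avg big_const iter_addr_0 -(mulr_natr k).
by rewrite mulfK // pnatr_eq0 -lt0n.
Qed.

Lemma avg_ge0 F : (forall t, 0 <= F t) -> 0 <= avg F.
Proof. by move=> F0; rewrite /avg divr_ge0 ?sumr_ge0. Qed.

End Average.

Lemma avg_pair (R : realType) (T1 T2 : finType) (F : T1 * T2 -> R) :
  avg F = avg (fun t1 => avg (fun t2 => F (t1, t2))).
Proof.
rewrite {2}/avg -mulr_suml -mulrA -invfM -natrM mulnC -card_prod.
by rewrite pair_bigA /avg; congr (_ / _); apply: eq_bigr => -[].
Qed.

(* Take [l = v / u] when both are positive. *)
Lemma le_mul_of_quad (R : realType) (m u v : R) : 0 <= u -> 0 <= v ->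
  (forall l, 0 < l -> 2 * l * m <= l ^+ 2 * u ^+ 2 + v ^+ 2) -> m <= u * v.
Proof.
move=> u0 v0 H; case: (leP m (u * v)) => // lt_m; exfalso.
have m0 : 0 < m by apply: le_lt_trans lt_m; apply: mulr_ge0.
move: u0; rewrite le_eqVlt => /orP[/eqP u0|u0].
  (* For [u = 0] the left side of [H] is unbounded in [l], while the right side stays [v ^+ 2]. *)
  move: (H ((v ^+ 2 + 1) / m)); rewrite -u0.
  have -> : 2 * ((v ^+ 2 + 1) / m) * m = 2 * (v ^+ 2 + 1).
    by field; rewrite gt_eqF.
  have v20 := sqr_ge0 v.
  rewrite divr_gt0 //; last by nra.
  by move=> /(_ isT); nra.
move: v0; rewrite le_eqVlt => /orP[/eqP v0|v0].
  move: (H (m / u ^+ 2)); rewrite -v0 divr_gt0 ?exprn_gt0 // => /(_ isT).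
  have -> : (m / u ^+ 2) ^+ 2 * u ^+ 2 + 0 ^+ 2 = m ^+ 2 / u ^+ 2.
    by field; rewrite gt_eqF.
  rewrite (_ : 2 * _ * m = 2 * (m ^+ 2 / u ^+ 2)); last by ring.
  have : 0 < m ^+ 2 / u ^+ 2 by rewrite divr_gt0 ?exprn_gt0.
  by lra.
have := H (v / u) (divr_gt0 v0 u0).
have -> : (v / u) ^+ 2 * u ^+ 2 + v ^+ 2 = 2 * (v / u) * (u * v).
  by field; rewrite gt_eqF.
by rewrite ler_pM2l ?mulr_gt0 ?invr_gt0 // leNgt lt_m.
Qed.

(** Cauchy-Schwarz, from averaging [(l * F - G) ^+ 2 >= 0]. Bounding the second moments by squares
    keeps square roots out of the later induction. *)
Lemma avg_mul_le (R : realType) (T : finType) (F G : T -> R) (u v : R) :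
  0 <= u -> 0 <= v ->
  avg (fun t => F t ^+ 2) <= u ^+ 2 -> avg (fun t => G t ^+ 2) <= v ^+ 2 ->
  avg (fun t => F t * G t) <= u * v.
Proof.
move=> u0 v0 Fu Gv; apply: le_mul_of_quad => // l l0.
rewrite -avgZ.
apply: (@le_trans _ _ (avg (fun t => l ^+ 2 * F t ^+ 2 + G t ^+ 2))).
  apply: ler_avg => t; have := sqr_ge0 (l * F t - G t); nra.
rewrite avgD avgZ lerD // ler_wpM2l ?sqr_ge0 //.
Qed.

(** * Multilinear polynomials at rotated points *)

Section Cube.
Variables (R : realType) (n : nat).
Implicit Types (x y : cube n) (i : 'I_n) (S D : {set 'I_n}).
Implicit Types (q : {set 'I_n} -> R) (z c s : 'I_n -> R).

Definition setc x i (b : bool) : cube n :=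
  [ffun j => if j == i then b else x j].

Definition setc2 (w : cube n * cube n) i (b : bool * bool) :=
  (setc w.1 i b.1, setc w.2 i b.2).

Lemma setcK x i b b' : setc (setc x i b) i b' = setc x i b'.
Proof. by apply/ffunP=> j; rewrite !ffunE; case: eqP. Qed.

Lemma setc_id x i : setc x i (x i) = x.
Proof. by apply/ffunP=> j; rewrite !ffunE; case: eqP => // ->. Qed.

(* [(w, b) |-> (setc2 w i b, i-th coordinates of w)] is an involution. *)
Lemma avg_setc2 i (F : cube n * cube n -> R) :
  avg F = avg (fun w => (F (setc2 w i (true, true)) + F (setc2 w i (true, false))
                + F (setc2 w i (false, true)) + F (setc2 w i (false, false))) / 4).
Proof.
rewrite /avg -mulr_suml; congr (_ / _).
pose h (u : (cube n * cube n) * (bool * bool)) :=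
  (setc2 u.1 i u.2, (u.1.1 i, u.1.2 i)).
have hK : involutive h.
  by move=> [[x y] [a b]]; rewrite /h /setc2 /= !setcK !setc_id !ffunE eqxx.
have E : \sum_u F (h u).1 = \sum_(u : (cube n * cube n) * (bool * bool)) F u.1.
  by rewrite [RHS](reindex_inj (inv_inj hK)).
move: E.
rewrite -(pair_bigA _ (fun w b => F (setc2 w i b))) /=.
rewrite -(pair_bigA _ (fun w (b : bool * bool) => F w)) /=.
under [X in X = _]eq_bigr => w _.
  rewrite -(pair_bigA _ (fun a b => F (setc2 w i (a, b)))) /= !big_bool /= !addrA; over.
move=> ->.
have -> : \sum_w \sum_(b : bool * bool) F w = 4 * \sum_w F w.
  rewrite mulr_sumr; apply: eq_bigr => w _.
  by rewrite sumr_const card_prod card_bool mulr_natl.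
by field.
Qed.

Lemma cube2_card_gt0 : (0 < #|{: cube n * cube n}|)%N.
Proof. by rewrite card_prod muln_gt0 card_ffun card_bool expn_gt0. Qed.

Definition sgn x i : R := Defs.coord R x i.

(** The coefficients may vary with the coordinate, so hybrids between [x] and a rotated point are
    again of this form. *)
Definition mix c s (w : cube n * cube n) i : R := c i * sgn w.1 i + s i * sgn w.2 i.

Definition ev q z : R := \sum_S q S * \prod_(i in S) z i.

(** In the splitting [q = q0 + z_i * q1] these are the coefficients of [q0] and [q1]. They vanish on
    sets containing [i], so neither part sees [z_i]. *)
Definition slice0 i q S : R := if i \in S then 0 else q S.
Definition slice1 i q S : R := if i \in S then 0 else q (i |: S).

Lemma sum_split i (F : {set 'I_n} -> R) :
  \sum_S F S = \sum_(S : {set 'I_n} | i \notin S) (F S + F (i |: S)).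
Proof.
rewrite big_split /= (bigID (fun S => i \in S)) /= addrC; congr (_ + _).
rewrite (reindex_onto (fun S => i |: S) (fun S => S :\ i)) /=; last first.
  by move=> S iS; rewrite setD1K.
apply: eq_bigl => S; rewrite setU11 /=.
apply/eqP/idP => [<-|iS]; first by rewrite !inE eqxx.
by rewrite setU1K.
Qed.

Lemma ev_slice i q z : ev q z = ev (slice0 i q) z + z i * ev (slice1 i q) z.
Proof.
have E q' : (forall S, i \in S -> q' S = 0) ->
    ev q' z = \sum_(S : {set 'I_n} | i \notin S) q' S * \prod_(i in S) z i.
  move=> q'0; rewrite /ev (bigID (fun S => i \in S)) /= big1 ?add0r // => S iS.
  by rewrite q'0 // mul0r.
rewrite (E (slice0 i q)); last by move=> S; rewrite /slice0 => ->.
rewrite (E (slice1 i q)); last by move=> S; rewrite /slice1 => ->.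
rewrite mulr_sumr -big_split /= /ev (sum_split i).
apply: eq_bigr => S iS; rewrite /slice0 /slice1 (negbTE iS) big_setU1 //=.
by rewrite [q (i |: S) * _]mulrCA.
Qed.

Lemma ev_indep i q z z' : (forall S, i \in S -> q S = 0) ->
  (forall j, j != i -> z j = z' j) -> ev q z = ev q z'.
Proof.
move=> q0 zz; apply: eq_bigr => S _.
have [iS|iS] := boolP (i \in S); first by rewrite q0 // !mul0r.
congr (_ * _); apply: eq_bigr => j jS; apply: zz.
by apply: contraNneq iS => <-.
Qed.

Lemma slice0_in i q S : i \in S -> slice0 i q S = 0. Proof. by rewrite /slice0 => ->. Qed.
Lemma slice1_in i q S : i \in S -> slice1 i q S = 0. Proof. by rewrite /slice1 => ->. Qed.

(** Both slices lose the coordinate [i]. The induction is on the size of a set [D] containing every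
    [S] with nonzero coefficient; for empty [D] only the constant term is left. *)
Lemma coef_ind (P : ({set 'I_n} -> R) -> Prop) :
  (forall q, (forall S, S != set0 -> q S = 0) -> P q) ->
  (forall i q, P (slice0 i q) -> P (slice1 i q) -> P q) ->
  forall q, P q.
Proof.
move=> P0 Pi q.
have : forall S, ~~ (S \subset [set: 'I_n]) -> q S = 0 by move=> S; rewrite subsetT.
move: q; have [m] := ubnP #|[set: 'I_n]|.
elim: m [set: 'I_n] => // m IH D ltD q qD.
have [D0|[i iD]] := set_0Vmem D.
  by apply: P0 => S S0; apply: qD; rewrite D0 subset0.
have ltm : (#|D :\ i| < m)%N by rewrite (cardsD1 i D) iD in ltD.
apply: (Pi i); apply: (IH _ ltm) => S; rewrite subsetD1 => nS.
- rewrite /slice0; case: ifP => // iS; apply: qD; move: nS; by rewrite iS andbT.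
- rewrite /slice1; case: ifP => // iS; apply: qD; move: nS.
  by rewrite iS andbT subUset sub1set iD.
Qed.

(** The average of [q(z) * q(z')] at points with coordinatewise correlation [k], by [avg_ev_mul].
    The weight [k = 3] is the one in the fourth-moment bound. *)
Definition wsum (k : R) q : R := \sum_(S : {set 'I_n}) k ^+ #|S| * q S ^+ 2.

Lemma wsum_split i k q : wsum k q = wsum k (slice0 i q) + k * wsum k (slice1 i q).
Proof.
rewrite /wsum !(sum_split i) mulr_sumr -big_split /=; apply: eq_bigr => S iS.
by rewrite /slice0 /slice1 (negbTE iS) setU11 cardsU1 iS add1n (exprS k); ring.
Qed.

Lemma wsum_ge0 k q : 0 <= k -> 0 <= wsum k q.
Proof. by move=> k0; apply: sumr_ge0 => S _; apply: mulr_ge0; rewrite ?sqr_ge0 ?exprn_ge0. Qed.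

Lemma ev_const q z : (forall S, S != set0 -> q S = 0) -> ev q z = q set0.
Proof.
move=> q0; rewrite /ev (bigD1 set0) //= big_set0 mulr1 big1 ?addr0 // => S S0.
by rewrite q0 // mul0r.
Qed.

Lemma wsum_const k q : (forall S, S != set0 -> q S = 0) -> wsum k q = q set0 ^+ 2.
Proof.
move=> q0; rewrite /wsum (bigD1 set0) //= cards0 expr0 mul1r big1 ?addr0 // => S S0.
by rewrite q0 // expr0n mulr0.
Qed.

Lemma mix_setc2 c s w i b j : j != i -> mix c s (setc2 w i b) j = mix c s w j.
Proof. by move=> ji; rewrite /mix /sgn /Defs.coord !ffunE (negbTE ji). Qed.

Lemma mix_setc2_id c s w i b :
  mix c s (setc2 w i b) i = c i * (-1) ^+ b.1 + s i * (-1) ^+ b.2.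
Proof. by rewrite /mix /sgn /Defs.coord !ffunE eqxx. Qed.

Lemma ev_setc2 c s w i b q :
  ev q (mix c s (setc2 w i b)) =
  ev (slice0 i q) (mix c s w) +
    (c i * (-1) ^+ b.1 + s i * (-1) ^+ b.2) * ev (slice1 i q) (mix c s w).
Proof.
rewrite (ev_slice i) mix_setc2_id; congr (_ + _ * _).
- by apply: (ev_indep (@slice0_in i q)) => j; apply: mix_setc2.
- by apply: (ev_indep (@slice1_in i q)) => j; apply: mix_setc2.
Qed.

(** Averaging over the [i]-th signs kills the cross terms between the two slices, as the coordinates
    have mean 0, and puts the factor [c i * c' i + s i * s' i] on the product of the upper
    slices. *)
Lemma avg_ev_mul c s c' s' k q :
  (forall i, c i * c' i + s i * s' i = k) ->
  avg (fun w => ev q (mix c s w) * ev q (mix c' s' w)) = wsum k q.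
Proof.
move=> hk; elim/coef_ind: q => [q q0|i q IHlo IHhi].
  rewrite wsum_const //; under eq_avg => w do rewrite !ev_const //.
  by rewrite avg_cst ?cube2_card_gt0 // expr2.
rewrite (avg_setc2 i) (wsum_split i) -IHlo -IHhi -avgZ -avgD.
apply: eq_avg => w; rewrite !ev_setc2 /= expr0 expr1 -(hk i).
by field.
Qed.

(** Write [q = A + z_i * B]. The odd moments of [z_i] vanish, its second moment is 1 and its fourth
    at most 2. Cauchy-Schwarz and induction then give [u ^+ 2 + 6 * u * v + 2 * v ^+ 2], which is at
    most [(u + 3 * v) ^+ 2]. *)
Lemma hypercontractive c s q :
  (forall i, c i ^+ 2 + s i ^+ 2 = 1) ->
  avg (fun w => ev q (mix c s w) ^+ 4) <= wsum 3 q ^+ 2.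
Proof.
move=> cs1; elim/coef_ind: q => [q q0|i q IHlo IHhi].
  rewrite wsum_const //; under eq_avg => w do rewrite !ev_const //.
  by rewrite avg_cst ?cube2_card_gt0 // -exprM.
rewrite (avg_setc2 i) (wsum_split i).
set u := wsum 3 (slice0 i q) in IHlo *; set v := wsum 3 (slice1 i q) in IHhi *.
have u0 : 0 <= u by apply: wsum_ge0.
have v0 : 0 <= v by apply: wsum_ge0.
set A := fun w => ev (slice0 i q) (mix c s w); set B := fun w => ev (slice1 i q) (mix c s w).
have AB : avg (fun w => A w ^+ 2 * B w ^+ 2) <= u * v.
  apply: avg_mul_le => //.
    by under eq_avg => w do rewrite -exprM.
  by under eq_avg => w do rewrite -exprM.
apply: (@le_trans _ _ (avg (fun w => A w ^+ 4 + (6 * (A w ^+ 2 * B w ^+ 2) + 2 * B w ^+ 4)))).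
  apply: ler_avg => w; rewrite !ev_setc2 /= expr0 expr1 -/(A w) -/(B w).
  have cs := cs1 i.
  set a := A w; set b := B w.
  have -> : 6 * (a ^+ 2 * b ^+ 2) = 6 * (c i ^+ 2 + s i ^+ 2) * (a ^+ 2 * b ^+ 2).
    by rewrite cs mulr1.
  have -> : 2 * b ^+ 4 = 2 * (c i ^+ 2 + s i ^+ 2) ^+ 2 * b ^+ 4.
    by rewrite cs expr1n mulr1.
  (* This square is the gap between [2 * (c ^+ 2 + s ^+ 2) ^+ 2] and the fourth moment
     [c ^+ 4 + 6 * c ^+ 2 * s ^+ 2 + s ^+ 4], times [b ^+ 4]. *)
  have : 0 <= ((c i ^+ 2 - s i ^+ 2) * b ^+ 2) ^+ 2 by apply: sqr_ge0.
  nra.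
rewrite !avgD !avgZ.
have : 0 <= v ^+ 2 by apply: sqr_ge0.
have -> : (u + 3 * v) ^+ 2 = u ^+ 2 + (6 * (u * v) + 9 * v ^+ 2) by ring.
move: IHlo IHhi; rewrite -/A -/B => IHlo IHhi; lra.
Qed.

End Cube.

(** * Smoothing *)

Section Noise.
Variables (R : realType) (n : nat).
Implicit Types (x y : cube n) (S : {set 'I_n}).

Lemma sgn_bound x i : -1 <= sgn R x i <= 1.
Proof. by rewrite /sgn /Defs.coord; case: (x i); rewrite ?expr0 ?expr1; lra. Qed.

(** For [0 <= r <= 1] this is, in [y], the density of an [r]-correlated copy of [x]; averaging [f]
    against it gives [T_r f] at [x]. *)
Definition kernel (r : R) x y : R := \prod_i (r * (sgn R x i * sgn R y i) + 1).

Lemma kernelE r x y : kernel r x y =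
  \sum_(S : {set 'I_n}) r ^+ #|S| * (\prod_(i in S) sgn R x i * \prod_(i in S) sgn R y i).
Proof.
rewrite /kernel bigA_distr; apply: eq_bigr => S _.
by rewrite -big_mkcond /= big_split /= big_split /= prodr_const.
Qed.

Lemma kernel_ge0 r x y : 0 <= r <= 1 -> 0 <= kernel r x y.
Proof.
move=> /andP[r0 r1]; apply: prodr_ge0 => i _.
have /andP[? ?] := sgn_bound x i; have /andP[? ?] := sgn_bound y i.
have : -1 <= sgn R x i * sgn R y i by nra.
nra.
Qed.

Lemma avg_kernel r x : avg (kernel r x) = 1.
Proof.
rewrite /avg.
have -> : \sum_y kernel r x y =
    \prod_(i < n) \sum_(b : bool) (r * (sgn R x i * (-1) ^+ b) + 1).
  by rewrite bigA_distr_bigA.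
rewrite (eq_bigr (fun=> 2)); last by move=> i _; rewrite big_bool /= expr0 expr1; ring.
rewrite prodr_const card_ord card_ffun card_bool card_ord natrX divff //.
by rewrite expf_neq0 // pnatr_eq0.
Qed.

Definition noisy (r : R) (f : cube n -> R) S : R := r ^+ #|S| * fourier f S.

Lemma ev_noisyE r f x : ev (noisy r f) (sgn R x) = avg (fun y => f y * kernel r x y).
Proof.
under eq_avg => y do rewrite kernelE mulr_sumr.
rewrite avg_sum; apply: eq_bigr => S _.
rewrite /noisy -mulrA [fourier f S * _]mulrC mulrA -avgZ; apply: eq_avg => y.
by rewrite /sgn; ring.
Qed.

(** [T_r f] averages [f] against a nonnegative kernel of mean 1. *)
Lemma noisy_bound r f x : 0 <= r <= 1 -> (forall y, -1 <= f y <= 1) ->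
  -1 <= ev (noisy r f) (sgn R x) <= 1.
Proof.
move=> r01 f1; rewrite ev_noisyE; apply/andP; split.
  rewrite -(avg_kernel r x) -mulN1r -avgZ; apply: ler_avg => y.
  by rewrite ler_wpM2r ?kernel_ge0 //; case/andP: (f1 y).
rewrite -[leRHS](avg_kernel r x); apply: ler_avg => y.
by rewrite ler_piMl ?kernel_ge0 //; case/andP: (f1 y).
Qed.

Lemma mix10 (w : cube n * cube n) (q : {set 'I_n} -> R) :
  ev q (mix (fun=> 1) (fun=> 0) w) = ev q (sgn R w.1).
Proof.
apply: eq_bigr => S _; congr (_ * _); apply: eq_bigr => i _.
by rewrite /mix mul1r mul0r addr0.
Qed.

Lemma wsum1_noisy r f : 0 <= r <= 1 -> (forall y, -1 <= f y <= 1) ->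
  wsum 1 (noisy r f) <= 1.
Proof.
move=> r01 f1.
rewrite -(@avg_ev_mul R n (fun=> 1) (fun=> 0) (fun=> 1) (fun=> 0)); last first.
  by move=> i; rewrite mulr1 mulr0 addr0.
rewrite -[leRHS](@avg_cst R (cube n * cube n)%type 1 (cube2_card_gt0 n)).
apply: ler_avg => w; rewrite mix10.
have /andP[? ?] := noisy_bound w.1 r01 f1; nra.
Qed.

Lemma bessel (f : cube n -> R) :
  (forall y, -1 <= f y <= 1) -> \sum_(S : {set 'I_n}) fourier f S ^+ 2 <= 1.
Proof.
move=> f1; have := @wsum1_noisy 1 f; rewrite ler01 lexx => /(_ isT f1).
by rewrite /wsum /noisy; under eq_bigr => S _ do rewrite !expr1n !mul1r.
Qed.

End Noise.

(** * Lindeberg replacement *)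

Section Lindeberg.
Variables (R : realType) (n : nat) (Z Z2 : R -> R) (K : R).
(** [Z2] stands for the second derivative of [Z]. Symmetrizing in [h] cancels the odd-order
    terms. *)
Hypothesis taylor : forall a h,
  - (K * h ^+ 4) <= Z (a + h) + Z (a - h) - 2 * Z a - Z2 a * h ^+ 2 <= K * h ^+ 4.
Implicit Types (c s : 'I_n -> R) (q : {set 'I_n} -> R).

Let avg4 (a b c s : R) :=
  (Z (a + (c + s) * b) + Z (a + (c - s) * b) + Z (a + (- c + s) * b)
    + Z (a + (- c - s) * b)) / 4.

(** The four increments form two pairs of opposites, [(c + s) * b] and [(c - s) * b] up to sign.
    Their second-order terms add up to a value independent of [c] and [s], and their fourth powers
    satisfy [(c + s) ^+ 4 + (c - s) ^+ 4 <= 4]. *)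
Let avg4_taylor (a b c s : R) : 0 <= K -> c ^+ 2 + s ^+ 2 = 1 ->
  - (K * b ^+ 4) <= avg4 a b c s - (Z a + Z2 a * b ^+ 2 / 2) <= K * b ^+ 4.
Proof.
move=> K0 cs1.
have /andP[l1 u1] := taylor a ((c + s) * b).
have /andP[l2 u2] := taylor a ((c - s) * b).
have E1 : a - (c + s) * b = a + (- c - s) * b by ring.
have E2 : a - (c - s) * b = a + (- c + s) * b by ring.
rewrite E1 in l1 u1; rewrite E2 in l2 u2.
have F : Z2 a * ((c + s) * b) ^+ 2 + Z2 a * ((c - s) * b) ^+ 2 = 2 * (Z2 a * b ^+ 2).
  rewrite -[2 * _]mulr1 -[X in _ = _ * X]cs1; ring.
have G : K * ((c + s) * b) ^+ 4 + K * ((c - s) * b) ^+ 4 <= 4 * (K * b ^+ 4).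
  have -> : 4 * (K * b ^+ 4) = 4 * (c ^+ 2 + s ^+ 2) ^+ 2 * (K * b ^+ 4).
    by rewrite cs1 expr1n mulr1.
  rewrite -subr_ge0 (_ : _ - _ = 2 * K * ((c ^+ 2 - s ^+ 2) * b ^+ 2) ^+ 2); last by ring.
  by rewrite mulr_ge0 ?sqr_ge0 // mulr_ge0.
rewrite /avg4; apply/andP; split; lra.
Qed.

(* The two random coordinates agree up to the third moment, so the replacement
   only costs the fourth-order Taylor remainder. *)
Lemma lindeberg_step i c s c' s' q : 0 <= K ->
  (forall j, c j ^+ 2 + s j ^+ 2 = 1) -> c' i ^+ 2 + s' i ^+ 2 = 1 ->
  (forall j, j != i -> c' j = c j /\ s' j = s j) ->
  avg (fun w => Z (ev q (mix c' s' w))) <=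
  avg (fun w => Z (ev q (mix c s w))) + 2 * K * wsum 3 (slice1 i q) ^+ 2.
Proof.
move=> K0 cs1 cs1' cc.
have P : avg (fun w => Z (ev q (mix c' s' w))) <=
    avg (fun w => Z (ev q (mix c s w))) + 2 * K * avg (fun w => ev (slice1 i q) (mix c s w) ^+ 4).
  rewrite (avg_setc2 i) [avg (fun w => Z (ev q (mix c s w)))](avg_setc2 i).
  rewrite -avgZ -avgD; apply: ler_avg => w.
  rewrite !ev_setc2 /= expr0 expr1 !mulr1 !mulrN1.
  have off q' : (forall S : {set 'I_n}, i \in S -> q' S = 0) ->
      ev q' (mix c' s' w) = ev q' (mix c s w).
    by move=> q0; apply: (ev_indep q0) => j /cc[e1 e2]; rewrite /mix e1 e2.
  rewrite !(off _ (@slice0_in _ _ i q)) !(off _ (@slice1_in _ _ i q)).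
  set a := ev _ _; set b := ev _ _.
  have /andP[_ U] := avg4_taylor a b K0 cs1'.
  have /andP[L _] := avg4_taylor a b K0 (cs1 i).
  rewrite /avg4 in U L; lra.
apply: (le_trans P); rewrite lerD2l ler_wpM2l ?mulr_ge0 //.
exact: hypercontractive.
Qed.

Lemma lindeberg c s q : 0 <= K -> (forall j, c j ^+ 2 + s j ^+ 2 = 1) ->
  avg (fun w => Z (ev q (mix c s w))) <=
  avg (fun w : cube n * cube n => Z (ev q (sgn R w.1))) +
    2 * K * \sum_i wsum 3 (slice1 i q) ^+ 2.
Proof.
move=> K0 cs1.
(* Hybrids: coordinates listed in [r] are rotated, all others still equal those of [x]. Induction on
   [r] replaces one coordinate at a time. *)
pose cr (r : seq 'I_n) i := if i \in r then c i else 1.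
pose sr (r : seq 'I_n) i := if i \in r then s i else 0.
have crs r j : cr r j ^+ 2 + sr r j ^+ 2 = 1.
  by rewrite /cr /sr; case: ifP => _; rewrite ?cs1 // expr1n expr0n addr0.
suff H r : avg (fun w => Z (ev q (mix (cr r) (sr r) w))) <=
    avg (fun w : cube n * cube n => Z (ev q (sgn R w.1))) +
      2 * K * \sum_(i <- r) wsum 3 (slice1 i q) ^+ 2.
  have := H (enum 'I_n); rewrite big_enum /=; apply: le_trans.
  rewrite le_eqVlt; apply/orP; left; apply/eqP; apply: eq_avg => w; congr Z.
  apply: eq_bigr => S _; congr (_ * _); apply: eq_bigr => i _.
  by rewrite /mix /cr /sr mem_enum.
elim: r => [|i r IH].
  rewrite big_nil mulr0 addr0 le_eqVlt; apply/orP; left; apply/eqP.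
  by apply: eq_avg => w; rewrite -mix10.
rewrite big_cons mulrDr addrA addrAC.
apply: le_trans (_ : _ <= avg (fun w => Z (ev q (mix (cr r) (sr r) w))) +
    2 * K * wsum 3 (slice1 i q) ^+ 2) _.
  apply: lindeberg_step => // j /negbTE ji.
  by rewrite /cr /sr inE ji.
by rewrite lerD2r.
Qed.

End Lindeberg.

(** * The penalty function and clipping to [-1, 1] *)

Section Penalty.
Variable R : realType.
Implicit Types a h t : R.

Definition pos a : R := Num.max a 0.

Lemma pos_ge0 a : 0 <= a -> pos a = a. Proof. by move=> ?; apply/max_idPl. Qed.
Lemma pos_le0 a : a <= 0 -> pos a = 0. Proof. by move=> ?; apply/max_idPr. Qed.

(** The second derivative of [pos a ^+ 4] is [12 * pos a ^+ 2], and its fourth derivative takes only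
    the values 0 and 24 away from the origin. *)
Lemma pos4_taylor a h :
  0 <= pos (a + h) ^+ 4 + pos (a - h) ^+ 4 - 2 * pos a ^+ 4 - 12 * pos a ^+ 2 * h ^+ 2
    <= 2 * h ^+ 4.
Proof.
wlog h0 : h / 0 <= h.
  move=> H; have [|/ltW h0] := leP 0 h; first exact: H.
  have := H (- h); rewrite oppr_ge0 => /(_ h0); rewrite opprK.
  by rewrite [pos (a - h) ^+ 4 + _]addrC sqrrN (_ : (- h) ^+ 4 = h ^+ 4) //; ring.
have [ah|ah] := leP h a.
  rewrite !pos_ge0; try lra.
  rewrite (_ : _ - _ = 2 * h ^+ 4); last by ring.
  by rewrite lexx andbT mulr_ge0 ?exprn_ge0.
have [ah'|ah'] := leP a (- h).
  rewrite !pos_le0; try lra.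
  rewrite !expr0n /= !mulr0 mul0r !subr0 addr0 lexx /=.
  by rewrite mulr_ge0 ?exprn_ge0.
rewrite (@pos_ge0 (a + h)); last lra.
rewrite (@pos_le0 (a - h)); last lra.
rewrite expr0n /= addr0.
have [a0|a0] := leP 0 a.
  rewrite pos_ge0 //; apply/andP; split.
    rewrite (_ : _ - _ = (h ^+ 2 - a ^+ 2) * (h ^+ 2 + a ^+ 2) +
        a * h * (h ^+ 2 + a ^+ 2 + 3 * (h - a) ^+ 2)); last by ring.
    have ? : 0 <= h ^+ 2 by apply: sqr_ge0.
    have ? : 0 <= a ^+ 2 by apply: sqr_ge0.
    have ? : 0 <= (h - a) ^+ 2 by apply: sqr_ge0.
    by rewrite addr_ge0 // mulr_ge0 ?mulr_ge0 //; nra.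
  (* With full fourth powers the expression is exactly [2 * h ^+ 4]; the absent term [(a - h) ^+ 4]
     is the gap. *)
  rewrite -subr_ge0 (_ : _ - _ = ((h - a) ^+ 2) ^+ 2); last by ring.
  exact: sqr_ge0.
rewrite (pos_le0 (ltW a0)) !expr0n /= !mulr0 mul0r !subr0.
rewrite exprn_ge0 /=; last lra.
have h40 : 0 <= h ^+ 4 by rewrite exprn_ge0.
apply: (@le_trans _ _ (h ^+ 4)); last lra.
by rewrite lerXn2r ?nnegrE //; lra.
Qed.

(* A second difference of [pos t ^+ 4]: it equals [t ^+ 4] on [[0, 1]] but only
   grows quadratically, so it can be compared with squared distances. *)
Definition cap t := pos t ^+ 4 - 2 * pos (t - 1) ^+ 4 + pos (t - 2) ^+ 4.

Definition cap2 t := 12 * (pos t ^+ 2 - 2 * pos (t - 1) ^+ 2 + pos (t - 2) ^+ 2).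

(** Three shifted errors from [0, 2 h^4] enter with weights 1, -2, 1. *)
Lemma cap_taylor a h :
  - (4 * h ^+ 4) <= cap (a + h) + cap (a - h) - 2 * cap a - cap2 a * h ^+ 2 <= 4 * h ^+ 4.
Proof.
have /andP[l0 u0] := pos4_taylor a h.
have /andP[l1 u1] := pos4_taylor (a - 1) h.
have /andP[l2 u2] := pos4_taylor (a - 2) h.
rewrite [a - 1 + h]addrAC [a - 1 - h]addrAC in l1 u1.
rewrite [a - 2 + h]addrAC [a - 2 - h]addrAC in l2 u2.
rewrite /cap /cap2; move: l0 u0 l1 u1 l2 u2.
move: (pos (a + h)) (pos (a - h)) (pos a) => x0 y0 z0.
move: (pos (a + h - 1)) (pos (a - h - 1)) (pos (a - 1)) => x1 y1 z1.
move: (pos (a + h - 2)) (pos (a - h - 2)) (pos (a - 2)) => x2 y2 z2.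
by move=> l0 u0 l1 u1 l2 u2; apply/andP; split; lra.
Qed.

Lemma cap_cases t :
  [\/ t <= 0 /\ cap t = 0,
      [/\ 0 <= t, t <= 1 & cap t = t ^+ 4],
      [/\ 1 <= t, t <= 2 & cap t = t ^+ 4 - 2 * (t - 1) ^+ 4] |
      2 <= t /\ cap t = 12 * (t - 1) ^+ 2 + 2].
Proof.
have [t0|/ltW t0] := leP t 0.
  constructor 1; split => //; rewrite /cap !pos_le0; lra.
have [t1|/ltW t1] := leP t 1.
  constructor 2; split => //; rewrite /cap (@pos_ge0 t) // !pos_le0; lra.
have [t2|/ltW t2] := leP t 2.
  constructor 3; split => //; rewrite /cap (@pos_le0 (t - 2)) ?pos_ge0; lra.
by constructor 4; split => //; rewrite /cap !pos_ge0; lra.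
Qed.

Lemma cap_le t : cap t <= 12 * pos t ^+ 2.
Proof.
have [[h ->]|[h0 h1 ->]|[h0 h1 ->]|[h ->]] := cap_cases t.
- by rewrite mulr_ge0 ?sqr_ge0.
- rewrite pos_ge0 //; have : 0 <= t ^+ 2 by apply: sqr_ge0.
  have : t ^+ 2 <= 1 by rewrite expr_le1.
  nra.
- rewrite pos_ge0; last lra.
  have : t ^+ 2 <= 4 by nra.
  have : 0 <= (t - 1) ^+ 4 by rewrite exprn_ge0 // subr_ge0.
  have : 0 <= t ^+ 2 by apply: sqr_ge0.
  nra.
- rewrite pos_ge0; last lra.
  nra.
Qed.

(** On [0, 1], either [t <= tau] or [t <= t ^+ 4 / tau ^+ 3], and [t ^+ 2 <= t]. Beyond 1,
    [t <= t ^+ 2 <= cap t]. *)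
Lemma cap_ge t tau : 0 < tau -> tau <= 1 ->
  pos t + pos t ^+ 2 <= 2 * (tau + cap t / tau ^+ 3).
Proof.
move=> tau0 tau1.
have tau30 : 0 < tau ^+ 3 by rewrite exprn_gt0.
have cap_div c : 0 <= c -> c <= c / tau ^+ 3.
  by move=> c0; rewrite ler_peMr // invf_ge1 // exprn_ile1 // ltW.
have [[h ->]|[h0 h1 ->]|[h0 h1 E]|[h E]] := cap_cases t.
- by rewrite pos_le0 // mul0r expr0n /= !addr0 mulr_ge0 ?ltW.
- rewrite pos_ge0 //.
  have : t <= tau + t ^+ 4 / tau ^+ 3.
    have [tt|/ltW tt] := leP t tau.
      by rewrite -[leLHS]addr0 lerD // divr_ge0 ?exprn_ge0 // ltW.
    rewrite -[leLHS]add0r lerD ?(ltW tau0) // ler_pdivlMr //.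
    by rewrite (exprS t) ler_wpM2l // lerXn2r ?nnegrE // ltW.
  have : t ^+ 2 <= t by nra.
  lra.
- have E' : t ^+ 2 <= cap t.
    rewrite E -subr_ge0 (_ : _ - _ = (t - 1) * (t ^+ 2 * (t + 1) - 2 * (t - 1) ^+ 3)); last by ring.
    apply: mulr_ge0; first lra.
    have : (t - 1) ^+ 3 <= 1 by rewrite exprn_ile1; lra.
    nra.
  rewrite pos_ge0; last lra.
  have : cap t <= cap t / tau ^+ 3 by apply: cap_div; nra.
  nra.
- have E' : t ^+ 2 <= cap t by rewrite E; nra.
  rewrite pos_ge0; last lra.
  have : cap t <= cap t / tau ^+ 3 by apply: cap_div; nra.
  nra.
Qed.

Definition penalty t := cap (t - 1) + cap (- t - 1).

Definition penalty2 t := cap2 (t - 1) + cap2 (- t - 1).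

Lemma penalty_taylor a h :
  - (8 * h ^+ 4) <= penalty (a + h) + penalty (a - h) - 2 * penalty a - penalty2 a * h ^+ 2
    <= 8 * h ^+ 4.
Proof.
have /andP[l0 u0] := cap_taylor (a - 1) h.
have /andP[l1 u1] := cap_taylor (- a - 1) h.
rewrite /penalty /penalty2.
have -> : a + h - 1 = a - 1 + h by ring.
have -> : a - h - 1 = a - 1 - h by ring.
have -> : - (a + h) - 1 = - a - 1 - h by ring.
have -> : - (a - h) - 1 = - a - 1 + h by ring.
move: (cap (a - 1 + h)) (cap (a - 1 - h)) (cap (a - 1)) (cap2 (a - 1)) l0 u0.
move: (cap (- a - 1 + h)) (cap (- a - 1 - h)) (cap (- a - 1)) (cap2 (- a - 1)) l1 u1.
by move=> ? ? ? ? ? ? ? ? ? ? ? ?; apply/andP; split; lra.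
Qed.

Lemma pos_le_dist t u : u <= 1 -> pos (t - 1) ^+ 2 <= (t - u) ^+ 2.
Proof.
move=> u1; have [t1|/ltW t1] := leP t 1.
  by rewrite pos_le0 ?subr_le0 // expr0n /= sqr_ge0.
by rewrite pos_ge0 ?subr_ge0 //; nra.
Qed.

(** Used with [t] the truncated polynomial and [u] the value of [T_r f] at the same cube point, so
    the penalty is paid by the truncation error. *)
Lemma penalty_le t u : -1 <= u <= 1 -> penalty t <= 24 * (t - u) ^+ 2.
Proof.
move=> /andP[uN1 u1]; have := pos_le_dist t u1.
have := @pos_le_dist (- t) (- u); rewrite lerNl => /(_ uN1).
have := cap_le (t - 1); have := cap_le (- t - 1); rewrite /penalty; nra.
Qed.

Definition clip t : R := Num.max (-1) (Num.min 1 t).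

Lemma clip_bound t : -1 <= clip t <= 1.
Proof. by rewrite /clip le_max lexx ge_max ge_min lexx /= andbT; lra. Qed.

(** At most one of the two overshoots is nonzero, so the squares add as well. *)
Lemma clipE t : `|t - clip t| = pos (t - 1) + pos (- t - 1) /\
  `|t - clip t| ^+ 2 = pos (t - 1) ^+ 2 + pos (- t - 1) ^+ 2.
Proof.
rewrite /clip; have [t1|/ltW t1] := leP t 1.
  rewrite (@pos_le0 (t - 1)); last lra.
  have [t2|/ltW t2] := leP (-1) t.
    by rewrite subrr normr0 pos_le0 ?expr0n ?addr0 //; lra.
  rewrite pos_ge0; last lra.
  by rewrite ler0_norm; [split; ring | lra].
have -> : Num.max (-1) 1 = 1 :> R by apply/max_idPr; lra.
rewrite pos_ge0 ?(@pos_le0 (- t - 1)); try lra.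
by rewrite ger0_norm; [split; ring | lra].
Qed.

Lemma clip_err t tau : 0 < tau -> tau <= 1 ->
  `|t - clip t| + `|t - clip t| ^+ 2 <= 4 * tau + 2 / tau ^+ 3 * penalty t.
Proof.
move=> t0 t1; have [-> ->] := clipE t.
have := cap_ge (t - 1) t0 t1; have := cap_ge (- t - 1) t0 t1.
rewrite /penalty; lra.
Qed.

End Penalty.

Lemma sum_path_le (R : realType) (b : nat -> R) k : (forall j, -1 <= b j <= 1) ->
  \sum_(j < k.+1) b j * b j.+1 <= k%:R + b 0%N * b k.+1.
Proof.
move=> b1; elim: k => [|k IH]; first by rewrite big_ord1 add0r.
rewrite big_ord_recr /= -[in leRHS]natr1.
have /andP[? ?] := b1 0%N; have /andP[? ?] := b1 k.+1; have /andP[? ?] := b1 k.+2.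
(* The inequality is affine in [b k.+1]; at its extreme values 1 and -1 it reads as the two products
   below being nonnegative. *)
have : b 0%N * b k.+1 + b k.+1 * b k.+2 <= 1 + b 0%N * b k.+2.
  have ? : 0 <= (1 - b 0%N) * (1 - b k.+2) by rewrite mulr_ge0 // ?subr_ge0 //; lra.
  have ? : 0 <= (1 + b 0%N) * (1 + b k.+2) by rewrite mulr_ge0 //; lra.
  nra.
lra.
Qed.

Lemma avg_prod (R : realType) (T1 T2 : finType) (F : T1 -> R) (G : T2 -> R) :
  avg (fun w => F w.1 * G w.2) = avg F * avg G.
Proof.
rewrite avg_pair /=; under eq_avg => t do rewrite avgZ mulrC.
by rewrite avgZ mulrC.
Qed.

(** * The rotation argument *)

Section Rotation.
Variables (R : realType) (n : nat).
Implicit Types (q : {set 'I_n} -> R) (c s : R).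

Definition rotated c s := @mix R n (fun=> c) (fun=> s).

Lemma avg_ev c s q : avg (fun w => ev q (rotated c s w)) = q set0.
Proof.
rewrite /rotated; elim/coef_ind: q => [q q0|i q IHlo IHhi].
  under eq_avg => w do rewrite ev_const //.
  by rewrite avg_cst ?cube2_card_gt0.
rewrite (avg_setc2 i) -[RHS](_ : slice0 i q set0 = _); last by rewrite /slice0 inE.
rewrite -IHlo; apply: eq_avg => w; rewrite !ev_setc2 /= expr0 expr1.
by field.
Qed.

Lemma ev_rotated10 q w : ev q (rotated 1 0 w) = ev q (sgn R w.1).
Proof. exact: mix10. Qed.

Lemma ev_rotated01 q w : ev q (rotated 0 1 w) = ev q (sgn R w.2).
Proof.
apply: eq_bigr => S _; congr (_ * _); apply: eq_bigr => i _.
by rewrite /rotated /mix mul1r mul0r add0r.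
Qed.

Definition err (t : R) := `|t - clip t| + `|t - clip t| ^+ 2.

Lemma clip_dist t : (clip t <= t + err t) && (t <= clip t + err t).
Proof.
have : 0 <= `|t - clip t| ^+ 2 by apply: exprn_ge0.
have := ler_norm (t - clip t); have := ler_norm (clip t - t).
by rewrite distrC /err => *; apply/andP; split; lra.
Qed.

(** With overshoots [x] and [y], the excess is [u * y + x * v + x * y]. The linear part of [err]
    covers the first two terms, the quadratic part the last. *)
Lemma err_mul a b : a * b <= clip a * clip b + (err a + err b).
Proof.
have ha := clip_bound a; have hb := clip_bound b.
rewrite /err; set u := clip a in ha *; set v := clip b in hb *.
have -> : a * b = (u + (a - u)) * (v + (b - v)) by ring.
move: (a - u) (b - v) => x y.
case/andP: ha => ? ?; case/andP: hb => ? ?.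
rewrite !real_normK ?num_real //.
have /andP[? ?] : - `|x| <= x <= `|x| by rewrite -ler_norml lexx.
have /andP[? ?] : - `|y| <= y <= `|y| by rewrite -ler_norml lexx.
have ? : u * y <= `|y|.
  by apply: le_trans (ler_norm _) _; rewrite normrM ler_piMl // ler_norml; lra.
have ? : x * v <= `|x|.
  by apply: le_trans (ler_norm _) _; rewrite normrM ler_piMr // ler_norml; lra.
have := sqr_ge0 (x - y); have := sqr_ge0 x; have := sqr_ge0 y.
nra.
Qed.

Lemma rotation_bound k q M : q set0 = 0 ->
  (forall c s, c ^+ 2 + s ^+ 2 = 1 -> avg (fun w => err (ev q (rotated c s w))) <= M) ->
  wsum (cos (pi / 2 / k.+1%:R)) q <= 1 - k.+1%:R^-1 + 3 * M.
Proof.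
move=> q0 hM; set th := pi / 2 / _.
have k0 : 0 < k.+1%:R :> R by rewrite ltr0Sn.
pose r j := rotated (cos (j%:R * th)) (sin (j%:R * th)).
have hMj j : avg (fun w => err (ev q (r j w))) <= M by apply: hM; exact: cos2Dsin2.
have err0 t : 0 <= err t by rewrite /err addr_ge0 // exprn_ge0.
have M0 : 0 <= M.
  by apply: le_trans (hMj 0%N); apply: avg_ge0 => w.
have corr (j : nat) : wsum (cos th) q = avg (fun w => ev q (r j w) * ev q (r j.+1 w)).
  rewrite (@avg_ev_mul _ _ _ _ _ _ (cos th)) // => i.
  (* Consecutive angles differ by [th], so the subtraction formula for the cosine gives the
     correlation. *)
  by rewrite mulrC [X in _ + X]mulrC -cosB -natr1 mulrDl mul1r addrAC subrr add0r.
have S1 : k.+1%:R * wsum (cos th) q =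
    avg (fun w => \sum_(j < k.+1) ev q (r j w) * ev q (r j.+1 w)).
  rewrite avg_sum (eq_bigr (fun=> wsum (cos th) q)) => [|j _]; last by rewrite -corr.
  by rewrite sumr_const card_ord mulr_natl.
have S2 : avg (fun w => \sum_(j < k.+1) ev q (r j w) * ev q (r j.+1 w)) <=
    avg (fun w => k%:R + clip (ev q (r 0%N w)) * clip (ev q (r k.+1 w))
      + \sum_(j < k.+1) (err (ev q (r j w)) + err (ev q (r j.+1 w)))).
  apply: ler_avg => w.
  apply: (@le_trans _ _ (\sum_(j < k.+1) (clip (ev q (r j w)) * clip (ev q (r j.+1 w))
      + (err (ev q (r j w)) + err (ev q (r j.+1 w)))))).
    by apply: ler_sum => j _; exact: err_mul.
  rewrite big_split /= lerD2r.
  by apply: (sum_path_le (b := fun j => clip (ev q (r j w)))) => j; exact: clip_bound.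
have S3 : avg (fun w => \sum_(j < k.+1) (err (ev q (r j w)) + err (ev q (r j.+1 w))))
    <= k.+1%:R * (2 * M).
  rewrite avg_sum mulr_natl -[in leRHS](card_ord k.+1) -sumr_const.
  by apply: ler_sum => j _; rewrite avgD; have := hMj j; have := hMj j.+1; lra.
have r0 w : ev q (r 0%N w) = ev q (sgn R w.1).
  by rewrite /r mul0r cos0 sin0 ev_rotated10.
have rk w : ev q (r k.+1 w) = ev q (sgn R w.2).
  by rewrite /r mulrC divfK ?gt_eqF // cos_pihalf sin_pihalf ev_rotated01.
(* The endpoints are independent, so their clipped product averages to [m ^+ 2]. As [q] has mean 0,
   [m] is at most [M] in absolute value, and with [m] in [-1, 1] this gives [m ^+ 2 <= M]. *)
pose m := avg (fun x : cube n => clip (ev q (sgn R x))).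
have S4 : avg (fun w => clip (ev q (r 0%N w)) * clip (ev q (r k.+1 w))) = m ^+ 2.
  under eq_avg => w do rewrite r0 rk.
  by rewrite (avg_prod (fun x => clip (ev q (sgn R x))) (fun x => clip (ev q (sgn R x)))).
have card1 : (0 < #|{: cube n}|)%N by rewrite card_ffun card_bool expn_gt0.
have mE : m = avg (fun w => clip (ev q (r 0%N w))).
  under eq_avg => w do rewrite r0 -[clip _]mulr1.
  rewrite (avg_prod (fun x : cube n => clip (ev q (sgn R x))) (fun _ : cube n => 1)).
  by rewrite avg_cst // mulr1.
have m1 : m <= 1.
  rewrite -[leRHS](avg_cst 1 card1); apply: ler_avg => x.
  by case/andP: (clip_bound (ev q (sgn R x))).
have mN1 : -1 <= m.
  rewrite -[leLHS](avg_cst (-1) card1); apply: ler_avg => x.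
  by case/andP: (clip_bound (ev q (sgn R x))).
have a0 := avg_ev (cos (0%:R * th)) (sin (0%:R * th)) q; rewrite q0 -/(r 0%N) in a0.
have hM0 := hMj 0%N.
have mM : m <= M.
  apply: le_trans hM0; rewrite -[leRHS]add0r -a0 -avgD mE; apply: ler_avg => w.
  exact: (andP (clip_dist _)).1.
have mNM : - M <= m.
  rewrite -[- M]add0r -a0 lerBlDr mE; apply: le_trans (lerD (lexx _) hM0).
  by rewrite -avgD; apply: ler_avg => w; exact: (andP (clip_dist _)).2.
have S5 : k.+1%:R * wsum (cos th) q <= k%:R + M + k.+1%:R * (2 * M).
  rewrite S1; apply: le_trans S2 _; rewrite !avgD S4 avg_cst ?cube2_card_gt0 //.
  by apply: lerD S3; rewrite lerD2l; nra.
have -> : 1 - k.+1%:R^-1 + 3 * M = (k%:R + 3 * (k.+1%:R * M)) / k.+1%:R.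
  by rewrite -natr1; field; rewrite natr1 gt_eqF.
rewrite ler_pdivlMr // mulrC; apply: le_trans S5 _.
have : 1 <= k.+1%:R :> R by rewrite ler1n.
nra.
Qed.

End Rotation.

(** * Truncation to low degree and the resulting stability bound *)

Section LowDegree.
Variables (R : realType) (n : nat).
Implicit Types (q : {set 'I_n} -> R) (S : {set 'I_n}) (f : cube n -> R).

Definition low d q S : R := if (#|S| <= d)%N then q S else 0.

Lemma sum_slice1 i q :
  \sum_(S : {set 'I_n}) slice1 i q S ^+ 2 =
  \sum_(S : {set 'I_n} | i \in S) q S ^+ 2.
Proof.
rewrite [RHS]big_mkcond /= !(sum_split i); apply: eq_bigr => S iS.
by rewrite /slice1 (negbTE iS) setU11 expr0n /= addr0 add0r.
Qed.

Lemma wsum_slice1_low d i q :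
  wsum 3 (slice1 i (low d q)) <= 3 ^+ d * \sum_(S : {set 'I_n} | i \in S) low d q S ^+ 2.
Proof.
rewrite -sum_slice1 mulr_sumr; apply: ler_sum => S _.
rewrite /slice1; case: ifP => iS; first by rewrite expr0n /= !mulr0.
rewrite /low cardsU1 iS add1n; case: ifP => Sd; last by rewrite expr0n /= !mulr0.
by rewrite ler_wpM2r ?sqr_ge0 // ler_eXn2l ?(ltnW Sd) //; lra.
Qed.

(** Double counting: a set of size at most [d] is counted at most [d] times. *)
Lemma sum_influences d q : \sum_S q S ^+ 2 <= 1 ->
  \sum_(i < n) \sum_(S : {set 'I_n} | i \in S) low d q S ^+ 2 <= d%:R.
Proof.
move=> q1; rewrite (exchange_big_dep predT) //=.
apply: (@le_trans _ _ (\sum_S d%:R * q S ^+ 2)); last first.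
  by rewrite -mulr_sumr ler_piMr.
apply: ler_sum => S _; rewrite sumr_const -[leLHS]mulr_natl /low.
case: leqP => Sd; last by rewrite expr0n /= mulr0 mulr_ge0 ?sqr_ge0.
by rewrite ler_wpM2r ?sqr_ge0 // ler_nat.
Qed.

(** Each term is at most [(3 ^+ d * a i) ^+ 2]; one factor [a i] is bounded by [I], the other is
    summed to at most [d]. *)
Lemma sum_slice1_low d q I : 0 <= I -> \sum_S q S ^+ 2 <= 1 ->
  (forall i, \sum_(S : {set 'I_n} | i \in S) q S ^+ 2 <= I) ->
  \sum_i wsum 3 (slice1 i (low d q)) ^+ 2 <= 9 ^+ d * d%:R * I.
Proof.
move=> I0 q1 qI.
pose a i := \sum_(S : {set 'I_n} | i \in S) low d q S ^+ 2.
have a0 i : 0 <= a i by apply: sumr_ge0 => S _; exact: sqr_ge0.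
have aI i : a i <= I.
  apply: le_trans (qI i); apply: ler_sum => S _.
  by rewrite /low; case: ifP => _ //; rewrite expr0n sqr_ge0.
apply: (@le_trans _ _ (\sum_i 9 ^+ d * I * a i)); last first.
  by rewrite -mulr_sumr mulrAC ler_wpM2r ?ler_wpM2l ?exprn_ge0 ?sum_influences.
apply: ler_sum => i _; have h := wsum_slice1_low d i q.
have w0 : 0 <= wsum 3 (slice1 i (low d q)) by apply: wsum_ge0.
apply: (@le_trans _ _ ((3 ^+ d * a i) ^+ 2)).
  by rewrite lerXn2r ?nnegrE // mulr_ge0 ?exprn_ge0.
rewrite exprMn -exprM mulnC exprM (_ : 3 ^+ 2 = 9) ?expr2; last by ring.
rewrite mulrA -!mulrA ler_wpM2l ?exprn_ge0 //.
by rewrite ler_wpM2r.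
Qed.

Lemma tail_le d (r : R) f : 0 <= r <= 1 -> \sum_S fourier f S ^+ 2 <= 1 ->
  \sum_S (noisy r f S - low d (noisy r f) S) ^+ 2 <= (r ^+ d) ^+ 2.
Proof.
move=> /andP[r0 r1] f1.
apply: (@le_trans _ _ (\sum_S (r ^+ d) ^+ 2 * fourier f S ^+ 2)); last first.
  by rewrite -mulr_sumr ler_piMr ?sqr_ge0.
apply: ler_sum => S _; rewrite /low; case: leqP => Sd.
  by rewrite subrr expr0n mulr_ge0 ?sqr_ge0.
rewrite subr0 /noisy exprMn ler_wpM2r ?sqr_ge0 // lerXn2r ?nnegrE ?exprn_ge0 //.
by apply: ler_wiXn2l => //; exact: ltnW.
Qed.

Lemma wsum_le_low d k q : 0 <= k <= 1 ->
  wsum k q <= wsum k (low d q) + \sum_S (q S - low d q S) ^+ 2.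
Proof.
move=> /andP[k0 k1]; rewrite /wsum -big_split /=; apply: ler_sum => S _.
rewrite /low; case: ifP => _; first by rewrite subrr expr0n /= addr0.
rewrite expr0n /= mulr0 add0r subr0 ler_piMl ?sqr_ge0 //.
exact: exprn_ile1.
Qed.

Lemma evB q q' (z : 'I_n -> R) : ev q z - ev q' z = ev (fun S => q S - q' S) z.
Proof. by rewrite /ev -sumrB; apply: eq_bigr => S _; rewrite mulrBl. Qed.

(** The first term is the penalty at cube points, bounded by 24 times the squared tail; the second
    is the Lindeberg cost of passing to the rotated point. *)
Lemma avg_penalty_low d r f I c s :
  0 <= r <= 1 -> 0 <= I -> (forall y, -1 <= f y <= 1) ->
  (forall i, influence f i <= I) -> c ^+ 2 + s ^+ 2 = 1 ->
  avg (fun w => penalty (ev (low d (noisy r f)) (rotated c s w)))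
    <= 24 * (r ^+ d) ^+ 2 + 16 * (9 ^+ d * d%:R * I).
Proof.
move=> r01 I0 f1 fI cs; have f2 := bessel f1.
have /andP[r0 r1] := r01.
have noisy_le S : noisy r f S ^+ 2 <= fourier f S ^+ 2.
  by rewrite /noisy exprMn ler_piMl ?sqr_ge0 // exprn_ile1 ?exprn_ge0 ?exprn_ile1.
have := @lindeberg R n (@penalty R) (@penalty2 R) 8 (@penalty_taylor R)
  (fun=> c) (fun=> s) (low d (noisy r f)).
move=> /(_ _ _)/le_trans; apply => //.
apply: lerD; last first.
  rewrite (_ : 2 * 8 = 16) ?ler_wpM2l //; last by ring.
  apply: sum_slice1_low => // [|i].
    by apply: le_trans f2; apply: ler_sum => S _.
  by apply: le_trans (fI i); apply: ler_sum => S _.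
apply: (@le_trans _ _ (24 * avg (fun w =>
   ev (fun S => noisy r f S - low d (noisy r f) S) (rotated 1 0 w) *
   ev (fun S => noisy r f S - low d (noisy r f) S) (rotated 1 0 w)))).
  rewrite -avgZ; apply: ler_avg => w; rewrite !ev_rotated10 -!evB.
  have := penalty_le (ev (low d (noisy r f)) (sgn R w.1)) (noisy_bound w.1 r01 f1).
  by rewrite -sqrrN opprB expr2.
rewrite (@avg_ev_mul _ _ _ _ _ _ 1); last by move=> i; rewrite mulr1 mulr0 addr0.
rewrite ler_wpM2l // /wsum.
under eq_bigr => S _ do rewrite expr1n mul1r.
exact: tail_le.
Qed.

Lemma stability_bound k d (r tau rho I : R) f :
  0 <= r <= 1 -> 0 <= I -> 0 < tau <= 1 -> (forall y, -1 <= f y <= 1) ->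
  expect f = 0 -> (forall i, influence f i <= I) ->
  24 * (r ^+ d) ^+ 2 + 16 * (9 ^+ d * d%:R * I) <= tau ^+ 4 ->
  0 <= rho <= r ^+ 2 * cos (pi / 2 / k.+1%:R) ->
  stability rho f <= 1 - k.+1%:R^-1 + 19 * tau.
Proof.
move=> r01 I0 /andP[t0 t1] f1 f0 fI hZ /andP[rho0].
set kap := cos _ => rhok; have /andP[r0 r1] := r01.
have kap1 : kap <= 1 by exact: cos_le1.
have kap0 : 0 <= kap.
  have pi0 := pi_ge0 R; apply: cos_ge0_pihalf; apply/andP; split.
    by apply: (@le_trans _ _ 0); rewrite ?oppr_le0 ?divr_ge0.
  by rewrite ler_piMr ?divr_ge0 // invf_le1 // ler1n.
(* The noise is split: [r ^+ 2] is absorbed in smoothing [f], and the rest, [kap], is the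
   correlation of one rotation step. *)
have S1 : stability rho f <= wsum kap (noisy r f).
  apply: ler_sum => S _; rewrite /noisy [(_ * fourier f S) ^+ 2]exprMn [leRHS]mulrA.
  rewrite ler_wpM2r ?sqr_ge0 //.
  rewrite -exprM mulnC exprM -exprMn lerXn2r ?nnegrE // 1?mulrC //.
  by rewrite mulr_ge0 // sqr_ge0.
have S2 := @wsum_le_low d kap (noisy r f); rewrite kap0 kap1 in S2.
have S3 := tail_le d r01 (bessel f1).
have tau4 : tau ^+ 4 <= tau by rewrite -[leRHS]expr1 ler_wiXn2l ?(ltW t0).
have S4 : (r ^+ d) ^+ 2 <= tau.
  apply: le_trans tau4; have : 0 <= 9 ^+ d * d%:R * I by rewrite !mulr_ge0 ?exprn_ge0.
  have := sqr_ge0 (r ^+ d); lra.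
(* In [6 * tau], [clip_err] contributes [4 * tau] directly and [2 / tau ^+ 3] times a penalty of at
   most [tau ^+ 4]. *)
have S5 : wsum kap (low d (noisy r f)) <= 1 - k.+1%:R^-1 + 3 * (6 * tau).
  apply: rotation_bound => [|c s cs].
    rewrite /low cards0 /= /noisy cards0 mul1r /fourier -[RHS]f0; congr (_ / _).
    by apply: eq_bigr => x _; rewrite big_set0 mulr1.
  apply: (@le_trans _ _ (avg (fun w => 4 * tau +
      2 / tau ^+ 3 * penalty (ev (low d (noisy r f)) (rotated c s w))))).
    by apply: ler_avg => w; exact: clip_err.
  rewrite avgD avg_cst ?cube2_card_gt0 // avgZ.
  have := le_trans (avg_penalty_low d r01 I0 f1 fI cs) hZ.
  have c0 : 0 <= 2 / tau ^+ 3 by rewrite divr_ge0 // exprn_ge0 // ltW.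
  move=> /(ler_wpM2l c0).
  rewrite (_ : 2 / tau ^+ 3 * tau ^+ 4 = 2 * tau); last by field; rewrite gt_eqF.
  by move=> H; apply: le_trans (lerD (lexx _) H) _; lra.
apply: le_trans S1 (le_trans (S2 isT) (le_trans (lerD S5 (le_trans S3 S4)) _)).
rewrite -addrA lerD2l; lra.
Qed.

End LowDegree.

(** * Choice of the parameters *)

Section Choices.
Variable R : realType.
Implicit Types (x eps : R).

Lemma sin_le x : 0 <= x -> sin x <= x.
Proof.
move=> x0.
have [|c _] := @MVT_segment R sin cos 0 x x0 (fun y _ => is_derive_sin y).
  exact/continuous_subspaceT/continuous_sin.
rewrite sin0 !subr0 => ->.
by rewrite ler_piMl // cos_le1.
Qed.

Lemma cos_ge x : 0 <= x <= pi -> 1 - x ^+ 2 / 2 <= cos x.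
Proof.
move=> /andP[x0 xpi].
have -> : cos x = 1 - 2 * sin (x / 2) ^+ 2.
  have -> : cos x = cos ((x / 2) *+ 2) by congr cos; rewrite -mulr_natr; field.
  by rewrite cos_mulr2n cos2sin2; ring.
have s0 : 0 <= sin (x / 2) by apply: sin_ge0_pi; apply/andP; split; lra.
have sx : sin (x / 2) <= x / 2 by apply: sin_le; lra.
nra.
Qed.

Lemma expR1_ge2 : 2 <= expR 1 :> R.
Proof. by have := expR_ge1Dx (1 : R); lra. Qed.

(** Uses [d <= 2 ^ d] and [9 * 2 <= 2 ^ 5 <= e ^ 5]. *)
Lemma pow9_le d : 9 ^+ d * d%:R <= expR (5 * d%:R) :> R.
Proof.
rewrite expRM_natr.
apply: (@le_trans _ _ (9 ^+ d * 2 ^+ d)).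
  by rewrite ler_wpM2l ?exprn_ge0 // -natrX ler_nat ltnW // ltn_expl.
rewrite -exprMn lerXn2r ?nnegrE ?expR_ge0 //; first by rewrite mulr_ge0.
rewrite -[5]mulr1 expRM_natl.
apply: (@le_trans _ _ (2 ^+ 5)); first by lra.
by rewrite lerXn2r ?nnegrE ?expR_ge0 ?expR1_ge2.
Qed.

Lemma degree_choice c eps : 0 < c -> c <= 1 -> 0 < eps -> eps <= expR (-1) ->
  exists d, (((1 - c * eps) ^+ d) ^+ 2 <= eps ^+ 4) /\
    9 ^+ d * d%:R * eps `^ ((10 / c + 9) / eps) <= eps ^+ 4.
Proof.
move=> c0 c1 e0 e1; pose L := - ln eps.
have eL : eps = expR (- L) by rewrite opprK lnK // posrE.
have L1 : 1 <= L by move: e1; rewrite eL ler_expR lerN2.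
have eps1 : eps <= 1 by apply: le_trans e1 _; rewrite expR_le1; lra.
have E4 : eps ^+ 4 = expR (- (4 * L)).
  by rewrite {1}eL -expRM_natl mulrN.
have ce0 : 0 < c * eps by rewrite mulr_gt0.
(* At degree [y] the bound [expR (- (2 * c * eps * y))] on the squared tail equals [eps ^+ 4]. *)
pose y := 2 * L / (c * eps).
have y0 : 0 <= y by rewrite divr_ge0 ?mulr_ge0 ?(ltW ce0) //; lra.
exists (Num.truncn y).+1; set d := _.+1.
have yd : y <= d%:R by rewrite ltW // truncnS_gt.
have dy : d%:R <= y + 1.
  by rewrite -natr1 lerD2r; case/andP: (truncn_itv y0).
split.
  apply: (@le_trans _ _ ((expR (- (c * eps)) ^+ d) ^+ 2)).
    have ? : 0 <= 1 - c * eps by nra.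
    rewrite lerXn2r ?nnegrE ?exprn_ge0 ?expR_ge0 // lerXn2r ?nnegrE ?expR_ge0 //.
    exact: expR_ge1Dx.
  rewrite -exprM -expRM_natr E4 ler_expR natrM.
  have : y * (c * eps) = 2 * L by rewrite /y divfK // gt_eqF.
  nra.
rewrite /powR gt_eqF // E4 -/(powR _ _) -(opprK (ln eps)) -/L.
apply: (@le_trans _ _ (expR (5 * d%:R) * expR ((10 / c + 9) / eps * - L))).
  by rewrite ler_wpM2r ?expR_ge0 ?pow9_le.
rewrite -expRD ler_expR.
(* The part [10 / c] of the exponent cancels [expR (5 * y)]; the part 9 pays for rounding [y] up,
   which costs 5, and for the target [eps ^+ 4], since [1 <= L <= L / eps]. *)
have E : (10 / c + 9) / eps * - L = - (5 * y) - 9 * (L / eps).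
  by rewrite /y; field; rewrite !gt_eqF.
have Le : L <= L / eps by rewrite ler_peMr ?invf_ge1 //; lra.
rewrite E; lra.
Qed.

Lemma step_choice c eps : 0 < c -> 2 * c < 1 -> 0 < eps -> eps < 1 ->
  exists k, (1 - eps <= (1 - c * eps) ^+ 2 * cos (pi / 2 / k.+1%:R)) /\
   Num.sqrt 8 / pi * Num.sqrt eps - (4 * c + 2 * Num.sqrt eps) * Num.sqrt eps <= k.+1%:R^-1.
Proof.
move=> c0 c1 e0 e1; set s : R := Num.sqrt eps; set a : R := Num.sqrt 8 / pi.
have pi0 := pi_gt0 R.
have s0 : 0 < s by rewrite sqrtr_gt0.
have s2 : s ^+ 2 = eps by rewrite sqr_sqrtr // ltW.
have q2 : Num.sqrt 8 ^+ 2 = 8 :> R by rewrite sqr_sqrtr.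
have q0 : 0 < Num.sqrt 8 :> R by rewrite sqrtr_gt0.
have a0 : 0 < a by rewrite divr_gt0.
have a2 : a * pi * (a * pi) = 8 by rewrite divfK ?gt_eqF // -expr2 q2.
have a2_le2 : a ^+ 2 <= 2.
  have pi2 := pi_ge2 R; have : 4 <= pi ^+ 2 :> R by nra.
  have := sqr_ge0 a; nra.
(* The target for [K^-1]: since [(a * pi) ^+ 2 = 8], the cosine is at least
   [1 - (1 - 2 * c) ^+ 2 * eps], leaving room for the smoothing loss of about [2 * c * eps]. *)
pose w := a * s * (1 - 2 * c).
have w0 : 0 < w by apply: mulr_gt0; [exact: mulr_gt0 | lra].
have w0' : 0 <= w^-1 by rewrite invr_ge0 ltW.
exists (Num.truncn w^-1); set K := (Num.truncn w^-1).+1%:R.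
have K0 : 0 < K by rewrite ltr0Sn.
have wK : w^-1 <= K by apply: ltW; rewrite /K truncnS_gt.
have Kw : K <= w^-1 + 1.
  by rewrite /K -natr1 lerD2r; case/andP: (truncn_itv w0').
have K1 : K^-1 <= 1 by rewrite invf_le1 // ler1n.
clearbody K; have v0 : 0 < K^-1 by rewrite invr_gt0.
have vw : K^-1 <= w by rewrite -(invrK w) lef_pV2 ?posrE ?invr_gt0.
have vw' : w <= K^-1 * (1 + w).
  rewrite mulrC ler_pdivlMr // mulrC.
  by have := ler_wpM2r (ltW w0) Kw; rewrite mulrDl mulVf ?gt_eqF // mul1r.
split.
  have := @cos_ge (pi / 2 / K).
  have piK : pi / K <= pi by rewrite ler_piMr // ltW.
  have piK0 : 0 < pi / K by rewrite divr_gt0.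
  have -> : 0 <= pi / 2 / K <= pi
    by rewrite mulrAC; move: (pi / K) piK piK0 => z ? ?; apply/andP; split; lra.
  move=> /(_ isT).
  have -> : (pi / 2 / K) ^+ 2 / 2 = pi ^+ 2 * K^-1 ^+ 2 / 8.
    by field; rewrite gt_eqF.
  have : pi ^+ 2 * K^-1 ^+ 2 <= pi ^+ 2 * w ^+ 2.
    by rewrite ler_wpM2l ?sqr_ge0 // lerXn2r ?nnegrE // ltW.
  have -> : pi ^+ 2 * w ^+ 2 = a * pi * (a * pi) * s ^+ 2 * (1 - 2 * c) ^+ 2.
    by rewrite /w; ring.
  rewrite a2 s2; move: (cos _) (pi ^+ 2 * K^-1 ^+ 2) => x y h1 h2.
  have h0 : 0 <= c * (1 - 2 * c) * eps by rewrite !mulr_ge0 ?ltW //; lra.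
  have h3 : 1 - (1 - 2 * c) * eps <= x by lra.
  have h4 : 1 - 2 * c * eps <= (1 - c * eps) ^+ 2 by nra.
  have h5 : 0 <= 1 - (1 - 2 * c) * eps by nra.
  apply: (@le_trans _ _ ((1 - 2 * c * eps) * (1 - (1 - 2 * c) * eps))).
    have : 0 <= c * (1 - 2 * c) * eps ^+ 2.
      by rewrite !mulr_ge0 ?sqr_ge0 //; lra.
    lra.
  by apply: ler_pM => //; nra.
have a_le2 : a <= 2 by nra.
have ws : w <= a * s by rewrite /w ler_piMr ?(ltW (mulr_gt0 a0 s0)) //; lra.
have w2 : w ^+ 2 <= 2 * s ^+ 2.
  apply: (@le_trans _ _ ((a * s) ^+ 2)); first by nra.
  by rewrite exprMn ler_wpM2r ?sqr_ge0.
(* Rounding [w^-1] up to [K] lowers the gain by at most [w ^+ 2 <= 2 * s ^+ 2]. *)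
have vww : K^-1 * w <= w ^+ 2 by rewrite expr2 ler_wpM2r // ltW.
have : a * s * c <= 2 * s * c by rewrite ler_wpM2r ?ler_wpM2r // ltW.
rewrite /w in vw' vww w2 *; lra.
Qed.

End Choices.

Theorem corollary2p10 (R : realType) (eta : R) (heta : 0 < eta) :
  exists C : R, exists eps0 : R,
    [/\ 0 < C, 0 < eps0, eps0 < 1 &
      forall eps : R, 0 < eps -> eps <= eps0 ->
      forall (n : nat) (f : cube n -> R),
        pm1_valued f ->
        expect f = 0 ->
        (forall i : 'I_n, influence f i <= eps `^ (C / eps)) ->
        stability (1 - eps) f
          <= 1 - (Num.sqrt 8 / pi - eta) * eps `^ (1 / 2)].
Proof.
pose h := Num.min eta 1.
have h0 : 0 < h by rewrite lt_min heta ltr01.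
have h1 : h <= 1 by rewrite ge_min lexx orbT.
have h_eta : h <= eta by rewrite ge_min lexx.
(* The losses, in units of [s], are [4 * c], [2 * s <= 2 * t] and [19 * t]; together they stay below
   [h]. *)
pose c := h / 16; pose t := h / 40.
have c0 : 0 < c by rewrite divr_gt0.
have t0 : 0 < t by rewrite divr_gt0.
exists (10 / c + 9), (Num.min (expR (-1)) (t ^+ 2 / 7)); split.
- by rewrite addr_gt0 ?divr_gt0.
- by rewrite lt_min expR_gt0 divr_gt0 ?exprn_gt0.
- by rewrite gt_min expR_lt1 oppr_lt0 ltr01.
move=> eps e0; rewrite le_min => /andP[e1 et] n f fpm f0 fI.
have eps1 : eps < 1 by apply: le_lt_trans e1 _; rewrite expR_lt1 oppr_lt0 ltr01.
have c1 : 2 * c < 1 by rewrite /c; lra.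
have [d [hd1 hd2]] := degree_choice c0 ltac:(lra) e0 e1.
have [k [hk1 hk2]] := step_choice c0 c1 e0 eps1.
rewrite mul1r powR12_sqrt ?(ltW e0) //; set s : R := Num.sqrt eps in hk2 *.
have s0 : 0 < s by rewrite sqrtr_gt0.
have s2 : s ^+ 2 = eps by rewrite sqr_sqrtr // ltW.
have st : s <= t by have := sqr_ge0 t; nra.
have ts1 : t * s <= 1 by rewrite /t in st *; nra.
(* Here [tau = t * s]. The left side is at most [40 * eps ^+ 4], and [7 * eps <= t ^+ 2] makes this
   at most [t ^+ 4 * eps ^+ 2]. *)
have hz : 24 * ((1 - c * eps) ^+ d) ^+ 2 +
    16 * (9 ^+ d * d%:R * eps `^ ((10 / c + 9) / eps)) <= (t * s) ^+ 4.
  apply: (@le_trans _ _ (40 * eps ^+ 4)); first lra.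
  have -> : (t * s) ^+ 4 = (t ^+ 2) ^+ 2 * eps ^+ 2 by rewrite -s2; ring.
  have : (7 * eps) ^+ 2 <= (t ^+ 2) ^+ 2.
    by rewrite lerXn2r ?nnegrE ?sqr_ge0 //; lra.
  have : 0 <= eps ^+ 2 by apply: sqr_ge0.
  have : eps ^+ 4 = eps ^+ 2 * eps ^+ 2 by ring.
  have : eps ^+ 2 <= 1 by rewrite expr_le1 // ltW.
  nra.
have f1 y : -1 <= f y <= 1 by case: (fpm y) => ->; lra.
have r01 : 0 <= 1 - c * eps <= 1 by apply/andP; split; nra.
have tau01 : 0 < t * s <= 1 by rewrite mulr_gt0.
have rho01 : 0 <= 1 - eps <= (1 - c * eps) ^+ 2 * cos (pi / 2 / k.+1%:R).
  by rewrite hk1 subr_ge0 ltW.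
apply: le_trans (stability_bound r01 (powR_ge0 _ _) tau01 f1 f0 fI hz rho01) _.
rewrite -addrA lerD2l.
have hs : (4 * c + 2 * s + 19 * t) * s <= h * s.
  by rewrite ler_wpM2r ?(ltW s0) // /c; rewrite /t in st *; lra.
have : h * s <= eta * s by rewrite ler_wpM2r // ltW.
by move: (Num.sqrt 8 / pi) (k.+1%:R^-1) hk2 => a v; lra.
Qed.
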